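(* Let $\Gamma$ be an infinite countable group, $1\le p<\infty$, and let $d$ be any distance on $B(\ell^p(\Gamma))$ compatible with its (product) topology. For every $\varepsilon>0$ there is a positive constant $C(d,p,\varepsilon)<\infty$ such that $$\mathrm{Widim}_\varepsilon\big(B(\ell^p(\Gamma)),d_\Omega\big)\le C(d,p,\varepsilon)\quad\text{for all (nonempty) finite sets }\Omega\subset\Gamma ,$$ where $C(d,p,\varepsilon)$ is independent of $\Omega$. Namely, $\mathrm{Widim}_\varepsilon(B(\ell^p(\Gamma)),d_\Omega)$ becomes stable for large $\Omega\subset\Gamma$: there is a finite set $\Omega_0\subset\Gamma$ such that $\mathrm{Widim}_\varepsilon(B(\ell^p(\Gamma)),d_\Omega)=\mathrm{Widim}_\varepsilon(B(\ell^p(\Gamma)),d_{\Omega_0})$ for all finite $\Omega\supset\Omega_0$. In particular, if $\Gamma$ is a finitely generated infinite amenable group, then $$\dim\big(B(\ell^p(\Gamma)):\Gamma\big)=0 .$$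
   Context: For a compact metric space $(X,d)$, a topological space $Y$ and $\varepsilon>0$, a continuous map $f:X\to Y$ is called an $\varepsilon$-embedding if $\mathrm{Diam}\, f^{-1}(y)\le\varepsilon$ for all $y\in Y$ (diameter with respect to $d$). $\mathrm{Widim}_\varepsilon(X,d)$ is the minimum integer $k\ge 0$ such that there exist a $k$-dimensional polyhedron $P$ (the underlying topological space of a $k$-dimensional simplicial complex) and an $\varepsilon$-embedding $f:X\to P$. $\ell^p(\Gamma)\subset\mathbb{R}^\Gamma$ is the real $\ell^p$-space and $B(\ell^p(\Gamma))=\{x\in\mathbb{R}^\Gamma:\sum_{\gamma\in\Gamma}|x_\gamma|^p\le1\}$ its closed unit ball, equipped with the restriction of the product topology of $\mathbb{R}^\Gamma$; with this topology it is compact and metrizable. $\Gamma$ acts continuously on it from the right by $(x\cdot\delta)_\gamma:=x_{\delta\gamma}$ for $x=(x_\gamma)_{\gamma\in\Gamma}$, $\delta\in\Gamma$. For a finite subset $\Omega\subset\Gamma$, $d_\Omega(x,y):=\max_{\gamma\in\Omega}d(x\gamma,y\gamma)$. If $\Gamma$ is finitely generated, an amenable sequence is a sequence $\{\Omega_i\}_{i\ge1}$ of nonempty finite subsets of $\Gamma$ such that for every $\rho>0$, $|\partial_\rho\Omega_i|/|\Omega_i|\to0$ as $i\to\infty$, where $\partial_\rho\Omega$ is the set of $\gamma\in\Gamma$ whose closed $\rho$-ball, for the left-invariant word metric of a finite generating set, meets both $\Omega$ and $\Gamma\setminus\Omega$. $\Gamma$ is amenable if it has such a sequence; the mean dimension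 is then defined, using an amenable sequence $\{\Omega_i\}$, by $$\dim(B(\ell^p(\Gamma)):\Gamma)=\lim_{\varepsilon\to0}\lim_{i\to\infty}\mathrm{Widim}_\varepsilon(B(\ell^p(\Gamma)),d_{\Omega_i})/|\Omega_i| .$$ *)

(* Defs.v *)
From HB Require Import structures.
From mathcomp Require Import all_boot all_order all_algebra.
From mathcomp Require Import finmap.
From mathcomp Require Import all_classical all_reals all_analysis.

Set Implicit Arguments.
Unset Strict Implicit.
Unset Printing Implicit Defensive.

Import Order.TTheory GRing.Theory Num.Theory.
Import numFieldTopology.Exports numFieldNormedType.Exports.

Local Open Scope classical_set_scope.
Local Open Scope ring_scope.

(* The least element of a set of natural numbers, and +oo if the set is empty. *)
Definition nat_min (R : realType) (A : set nat) : \bar R :=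
  ereal_inf [set (n%:R)%:E | n in A].

(* Abstract simplicial complexes, with a possibly infinite set of vertices.
   An element of V need not be a vertex of the complex. *)
Record simplicial_complex (V : choiceType) := SimplicialComplex {
  simplices : set {fset V};
  simplices_neq0 : forall s, simplices s -> s != fset0;
  simplices_sub : forall s t : {fset V},
    simplices s -> t != fset0 -> (t `<=` s)%fset -> simplices t }.

Definition complex_dim (V : choiceType) (K : simplicial_complex V) (k : nat) :=
  (exists2 s, simplices K s & #|` s|%fset = k.+1) /\
  (forall s, simplices K s -> (#|` s|%fset <= k.+1)%N).

(* The closed simplex spanned by s, in barycentric coordinates. *)
Definition face (R : realType) (V : choiceType) (s : {fset V}) :
    set {ptws V -> R} :=
  [set x | [/\ forall v, 0 <= x v, forall v, v \notin s -> x v = 0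
             & \sum_(v <- s) x v = 1]].

Definition polyhedron_set (R : realType) (V : choiceType)
    (K : simplicial_complex V) : set {ptws V -> R} :=
  [set x | exists2 s, simplices K s & face s x].

(* A separate constant, because [set_type] already carries the subspace
   topology, and the polyhedron of an infinite complex has the weak topology. *)
Definition polyhedron (R : realType) (V : choiceType)
    (K : simplicial_complex V) : Type := set_type (@polyhedron_set R V K).

Section weak_topology.
Context (R : realType) (V : choiceType) (K : simplicial_complex V).
Local Notation P := (@polyhedron R V K).

HB.instance Definition _ := Choice.copy P (set_type (@polyhedron_set R V K)).

Definition polyhedron_coord (x : P) : {ptws V -> R} := set_val x.

(* U is open iff its trace on every closed simplex is relatively open. *)
Definition polyhedron_open : set_system P :=
  [set U | forall s, simplices K s ->
     exists2 W : set {ptws V -> R}, open W &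
       forall x : P, face s (polyhedron_coord x) ->
         (U x <-> W (polyhedron_coord x))].

Let polyhedron_openT : polyhedron_open setT.
Proof. by move=> s _; exists setT => //; exact: openT. Qed.

Let polyhedron_openI : setI_closed polyhedron_open.
Proof.
move=> A B oA oB s Ks.
have [W oW AW] := oA s Ks; have [W' oW' BW'] := oB s Ks.
exists (W `&` W'); first exact: openI.
by move=> x sx; split=> -[] => [/(AW _ sx) ? /(BW' _ sx)|/(AW _ sx) ? /(BW' _ sx)].
Qed.

Let polyhedron_open_bigU (I : Type) (f : I -> set P) :
  (forall i, polyhedron_open (f i)) -> polyhedron_open (\bigcup_i f i).
Proof.
move=> of_ s Ks.
have /choice[W HW] : forall i, exists W : set {ptws V -> R}, open W /\
    forall x : P, face s (polyhedron_coord x) ->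
      (f i x <-> W (polyhedron_coord x)).
  by move=> i; have [W oW H] := of_ i s Ks; exists W.
exists (\bigcup_i W i); first by apply: bigcup_open => i _; have [] := HW i.
by move=> x sx; split=> -[i _ Hi]; exists i => //; apply/(HW i).2.
Qed.

HB.instance Definition _ := isOpenTopological.Build P
  polyhedron_openT polyhedron_openI polyhedron_open_bigU.

End weak_topology.

Section widim.
Context (R : realType) (X : topologicalType) (d : X -> X -> R).

Definition is_distance :=
  [/\ forall x y, d x y = 0 <-> x = y,
      forall x y, d x y = d y x
    & forall x y z, d x z <= d x y + d y z].

Definition compatible_distance :=
  forall (x : X) (A : set X),
    nbhs x A <-> exists2 r, 0 < r & [set y | d x y < r] `<=` A.

(* -oo for the empty set. *)
Definition diameter (A : set X) : \bar R :=
  ereal_sup [set (d x y)%:E | x in A & y in A].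

Definition eps_embedding (eps : R) (Y : topologicalType) (f : X -> Y) :=
  continuous f /\ forall y, (diameter (f @^-1` [set y]) <= eps%:E)%E.

Definition Widim (eps : R) : \bar R :=
  nat_min R [set k | exists (V : choiceType) (K : simplicial_complex V)
    (f : X -> polyhedron R K), complex_dim K k /\ eps_embedding eps f].

End widim.

Section lp_ball.
Context (R : realType) (G : groupType) (p : R).

Definition lp_ball_set : set {ptws G -> R} :=
  [set x | (\esum_(g in [set: G]) (`|x g| `^ p)%:E <= 1)%E].

(* [set_type] carries the topology induced by the product topology. *)
Definition lp_ball : topologicalType := set_type lp_ball_set.

Lemma lp_ball_act_subproof (g : G) (x : lp_ball) :
  (fun h => set_val x (g * h)%g) \in lp_ball_set.
Proof.
have /set_mem := valP x; rewrite /lp_ball_set /= => xB.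
apply/mem_set; rewrite /lp_ball_set /=; apply: le_trans xB.
rewrite le_eqVlt; apply/orP; left; apply/eqP; symmetry.
apply: (@reindex_esum R G G [set: G] [set: G] (fun h => (g * h)%g)).
split=> // [h h' _ _|h _]; first exact: mulgI.
by exists (g^-1 * h)%g => //; rewrite mulVKg.
Qed.

Definition lp_ball_act (x : lp_ball) (g : G) : lp_ball :=
  exist _ (fun h => set_val x (g * h)%g) (lp_ball_act_subproof g x).

(* Only meaningful for nonempty Om; distances are nonnegative, so the default
   value 0 of the maximum is then harmless. *)
Definition dist_on (d : lp_ball -> lp_ball -> R) (Om : {fset G})
    (x y : lp_ball) : R :=
  \big[Num.max/0]_(g <- Om) d (lp_ball_act x g) (lp_ball_act y g).

End lp_ball.

Section word_metric.
Context (R : realType) (G : groupType) (S : {fset G}).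

Definition is_word (g : G) (w : seq G) :=
  {in w, forall s, s \in S \/ (s^-1)%g \in S} /\ (\prod_(s <- w) s)%g = g.

Definition generates := forall g, exists w, is_word g w.

Definition word_dist (g h : G) : \bar R :=
  nat_min R [set n | exists2 w, is_word (g^-1 * h)%g w & size w = n].

Definition word_ball (g : G) (rho : R) : set G :=
  [set h | (word_dist g h <= rho%:E)%E].

Definition boundary (rho : R) (Om : {fset G}) : set G :=
  [set g | (word_ball g rho `&` [set` Om] !=set0) /\
           (word_ball g rho `\` [set` Om] !=set0)].

(* Balls of the word metric of a finite set are finite, hence so is
   [boundary rho (Om i)], and [fset_set] returns that very set. *)
Definition amenable_sequence (Om : nat -> {fset G}) :=
  (forall i, Om i != fset0) /\
  forall rho : R, 0 < rho ->
    (fun i => #|` fset_set (boundary rho (Om i))|%fset%:R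
              / #|` Om i|%fset%:R : R) @ \oo --> (0 : R).

End word_metric.

Section mean_dimension.
Context (R : realType) (G : groupType) (p : R).
Context (d : lp_ball G p -> lp_ball G p -> R) (Om : nat -> {fset G}).

Definition widim_ratio (eps : R) (i : nat) : \bar R :=
  (Widim (dist_on d (Om i)) eps * ((#|` Om i|%fset%:R)^-1)%:E)%E.

Definition widim_density (eps : R) : \bar R :=
  lim (widim_ratio eps i @[i --> \oo]).

Definition mean_dim : \bar R := lim (widim_density eps @[eps --> 0^'+]).

(* [lim] is total, so the existence of both limits has to be asserted apart. *)
Definition mean_dim_exists :=
  (forall eps, 0 < eps -> cvg (widim_ratio eps i @[i --> \oo])) /\
  cvg (widim_density eps @[eps --> 0^'+]).

End mean_dimension.

(* Main.v *)
Require Import Defs.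
From HB Require Import structures.
From mathcomp Require Import all_boot all_order all_algebra.
From mathcomp Require Import finmap.
From mathcomp Require Import all_classical all_reals all_analysis.
From mathcomp Require Import lra.

Set Implicit Arguments.
Unset Strict Implicit.
Unset Printing Implicit Defensive.

Import Order.TTheory GRing.Theory Num.Theory.
Import numFieldTopology.Exports numFieldNormedType.Exports.

Local Open Scope classical_set_scope.
Local Open Scope ring_scope.

(* Soft thresholding the coordinates at level delta moves each of them by at
   most delta and leaves at most delta^-p nonzero ones, so it maps the ball into
   a complex whose dimension does not depend on how many coordinates are kept.
   By compactness, d x y <= eps as soon as x and y agree up to eta on some
   finite set A of coordinates; keeping the coordinates in the finite set Om * A
   and thresholding at eta / 2 gives an eps-embedding for d_Om, whence the
   uniform bound. Stability follows since Widim is integer valued and monotone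
   in Om. As to the mean dimension, in an infinite group a nonempty finite set
   has a nonempty 1-boundary, so 1 / |Om_i| is at most the boundary ratio and
   tends to 0. Only finitely many coordinates can be kept: the thresholded ball
   itself is not contained in any finite subcomplex, hence thresholding all the
   coordinates is not continuous for the weak topology. *)

(** * Minima of sets of integers, and monotonicity of [Widim] *)

Lemma nat_min_attained (R : realType) (A : set nat) :
  A !=set0 -> exists2 n, A n & nat_min R A = n%:R%:E.
Proof.
case=> a Aa; have exA : exists n, `[< A n >] by exists a; exact/asboolP.
case: (ex_minnP exA) => n /asboolP An n_min; exists n => //.
apply/eqP; rewrite eq_le; apply/andP; split.
  by apply: ereal_inf_lbound; exists n.
apply: le_ereal_inf_tmp => _ [m Am <-].
by rewrite lee_fin ler_nat; apply: n_min; exact/asboolP.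
Qed.

(** A finite upper bound excludes the empty set, whose minimum is [+oo]; otherwise the minimum is
    attained. *)
Lemma nat_min_le (R : realType) (A : set nat) (x : R) :
  (nat_min R A <= x%:E)%E -> exists2 n, A n & n%:R <= x.
Proof.
have [->|/set0P/(nat_min_attained R)[n An ->] xn] := eqVneq A set0.
  by rewrite /nat_min image_set0 ereal_inf0.
by exists n; rewrite // -lee_fin.
Qed.

(** Fibres have smaller diameter for the smaller distance, so every [eps]-embedding for [d'] is one
    for [d]. *)
Lemma le_Widim (R : realType) (X : topologicalType) (d d' : X -> X -> R)
    (eps : R) :
  (forall x y, d x y <= d' x y) -> (Widim d eps <= Widim d' eps)%E.
Proof.
move=> dd'; apply: ereal_inf_le_tmp => _ [n [V [K [f [dimK [cf fd']]]]] <-].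
exists n => //; exists V, K, f; split=> //; split=> // y.
apply: le_trans (fd' y); apply: ge_ereal_sup => _ [x fx [x' fx' <-]].
apply: (@le_trans _ _ (d' x x')%:E); first by rewrite lee_fin.
by apply: ereal_sup_ubound; exists x => //; exists x'.
Qed.

(** * Convergence and compactness in subspaces and products *)

Lemma set_type_cvg (T : topologicalType) (A : set T)
    (F : set_system (set_type A)) (x : set_type A) :
  Filter F -> set_val @ F --> set_val x -> F --> x.
Proof.
move=> FF Fx U [_ [[W oW <-] /= Wx WU]].
by apply: filterS WU _; apply: Fx; exact: open_nbhs_nbhs.
Qed.

Lemma ptws_cvg (V : choiceType) (T : topologicalType)
    (F : set_system {ptws V -> T}) (l : {ptws V -> T}) :
  Filter F -> (forall v, x v @[x --> F] --> l v) -> F --> l.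
Proof.
move=> FF Fl; apply/cvg_sup => v; apply/cvg_image.
  by apply/seteqP; split=> // t _; exists (fun=> t).
move=> U /Fl FU; exists ((fun x => x v) @^-1` U) => //.
by apply/seteqP; split=> [_ [x Ux <-] //|t Ut]; exists (fun=> t).
Qed.

Lemma ptws_coord_continuous (V : choiceType) (T : topologicalType) (v : V) :
  continuous (fun x : {ptws V -> T} => x v).
Proof. exact: (@proj_continuous V (fun=> T) v). Qed.

Lemma compact_set_type (T : topologicalType) (A : set T) :
  compact A -> compact [set: set_type A].
Proof.
move=> cA F PF _.
have FA : (set_val @ F) A.
  by apply: (@filterS _ F _ setT) filterT => x _; exact: set_mem (valP x).
have [a [Aa clFa]] := cA _ _ FA.
exists (exist _ a (mem_set Aa)); split=> // B U FB [_ [[W oW <-] /= Wa WU]].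
have FB' : (set_val @ F) (set_val @` B).
  by apply: (@filterS _ F _ B) FB => x Bx; exists x.
have [_ [[x Bx <-] Wx]] := clFa _ W FB' (open_nbhs_nbhs (conj oW Wa)).
by exists x; split=> //; exact: WU.
Qed.

(** Away from [0] the power is differentiable; at [0], the bound [|s| ^ p <= |s|] for [|s| <= 1]
    gives the limit, thanks to [1 <= p]. *)
Lemma norm_powR_continuous (R : realType) (p : R) :
  1 <= p -> continuous (fun t : R => `|t| `^ p).
Proof.
move=> p_ge1 t; have p_gt0 : 0 < p by exact: lt_le_trans p_ge1.
have [->|t_neq0] := eqVneq t 0; last first.
  have t_gt0 : 0 < `|t| by rewrite normr_gt0.
  apply: (@cvg_comp _ _ _ Num.norm (fun s : R => s `^ p) _ (nbhs `|t|)).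
    exact: norm_continuous.
  have [/derivable1_diffP/differentiable_continuous] := is_derive1_powR p t_gt0.
  exact.
rewrite /continuous_at normr0 powR0 ?gt_eqF//.
apply/cvgr0Pnorm_le => e e_gt0.
near=> s; rewrite ger0_norm ?powR_ge0//.
have s1 : `|s| <= 1 by near: s; apply: cvgr0_norm_le.
have se : `|s| <= e by near: s; apply: cvgr0_norm_le.
have [->|s0] := eqVneq s 0; first by rewrite normr0 powR0 ?gt_eqF ?ltW.
by apply: le_trans se; apply: ge1r_powR; rewrite ?normr_gt0 ?s0.
Unshelve. all: by end_near. Qed.

Lemma sum_continuous (R : realType) (T : topologicalType) (I : Type)
    (r : seq I) (f : I -> T -> R) :
  (forall i, continuous (f i)) -> continuous (fun x => \sum_(i <- r) f i x).
Proof.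
move=> cf x; apply: cvg_big => [|i _]; last exact: cf.
exact: add_continuous.
Qed.

(** * Polyhedra: the weak topology and skeletons *)

Lemma face_closed (R : realType) (V : choiceType) (s : {fset V}) :
  closed (@face R V s).
Proof.
rewrite (_ : face s = (\bigcap_v [set x | 0 <= x v]) `&`
    (\bigcap_(v in [set v | v \notin s]) [set x | x v = 0]) `&`
    [set x | \sum_(v <- s) x v = 1]); last first.
  apply/seteqP; split=> [x [x_ge0 x0 x1]|x [[x_ge0 x0] x1]].
    by split=> //; split=> // v _; exact: x_ge0.
  by split=> [v|v|//]; [exact: x_ge0|exact: x0].
have cl (T : topologicalType) (f : T -> R) (D : set R) :
    continuous f -> closed D -> closed (f @^-1` D).
  by move=> cf; apply: preimage_closed => ? _; exact: cf.
apply: closedI; first apply: closedI.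
- apply: closed_bigI => v _; apply: (cl {ptws V -> R} (fun x => x v) [set t | 0 <= t]).
    exact: ptws_coord_continuous.
  exact: closed_ge.
- apply: closed_bigI => v _; apply: (cl {ptws V -> R} (fun x => x v) [set 0]).
    exact: ptws_coord_continuous.
  exact: closed_eq.
- apply: (cl {ptws V -> R} (fun x => \sum_(v <- s) x v) [set 1]); last exact: closed_eq.
  by apply: sum_continuous => v; exact: ptws_coord_continuous.
Qed.

(* The weak topology agrees with the product topology on finite subcomplexes,
   because the closed simplices are closed in the product. *)
Lemma continuous_polyhedron (R : realType) (V : choiceType)
    (K : simplicial_complex V) (X : topologicalType) (f : X -> polyhedron R K)
    (F : {fset V}) :
  (forall v, continuous (fun x => polyhedron_coord (f x) v)) ->
  (forall x, exists s, [/\ simplices K s, (s `<=` F)%fset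
                         & face s (polyhedron_coord (f x))]) ->
  continuous f.
Proof.
move=> cf fF; apply/continuousP => U oU; rewrite openE => x Ux.
have cvf : polyhedron_coord (f x') @[x' --> x] --> polyhedron_coord (f x).
  by apply: ptws_cvg => v; exact: cf.
(* If [f x] lies in the face, the trace [W] of [U] is a neighbourhood of it; if not, the complement
   of the closed face keeps nearby values out of that face. Finitely many faces then allow an
   intersection of neighbourhoods. *)
have near_face s : s \in fpowerset F ->
    \forall x' \near x, simplices K s ->
      face s (polyhedron_coord (f x')) -> U (f x').
  move=> _; have [Ks|nKs] := pselect (simplices K s); last first.
    by apply: nearW => x' Ks; case: nKs.
  have [W oW UW] := oU s Ks.
  have [sx|nsx] := pselect (face s (polyhedron_coord (f x))).
    have : nbhs (polyhedron_coord (f x)) W.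
      by apply: open_nbhs_nbhs; split=> //; exact/(UW _ sx).
    move=> /cvf; apply: (@filterS X (nbhs x)) => x' Wx' _ sx'; exact/(UW _ sx').
  have : nbhs (polyhedron_coord (f x)) (~` face s).
    by apply: open_nbhs_nbhs; split=> //; exact/closed_openC/face_closed.
  by move=> /cvf; apply: (@filterS X (nbhs x)) => x' nsx' _ /nsx'.
have := @filter_bigI X _ (fpowerset F) (fun s => [set x' | simplices K s ->
  face s (polyhedron_coord (f x')) -> U (f x')]) _ (nbhs_filter x) near_face.
apply: (@filterS X (nbhs x)) => x' nx'; have [s [Ks sF sx']] := fF x'.
by apply: (nx' s) => //=; rewrite fpowersetE.
Qed.

Program Definition skeleton (V : choiceType) (n : nat) :=
  @SimplicialComplex V [set s | s != fset0 /\ (#|` s|%fset <= n.+1)%N] _ _.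
Next Obligation. by move=> V n s []. Qed.
Next Obligation.
move=> V n s t [_ sn] t0 ts; split=> //.
exact: leq_trans (fsubset_leq_card ts) sn.
Qed.

(** An infinite vertex set supplies a simplex with [n.+1] vertices, so that the dimension is exactly
    [n]. *)
Lemma skeleton_dim (V : choiceType) (n : nat) :
  infinite_set [set: V] -> complex_dim (skeleton V n) n.
Proof.
move=> /(infinite_set_fset n.+1)[B _ nB]; split; last by move=> s [].
exists [fset v in take n.+1 B]%fset; last first.
  by rewrite card_fseq undup_id ?take_uniq ?fset_uniq// size_takel.
split; last by rewrite card_fseq undup_id ?take_uniq ?fset_uniq// size_takel.
by rewrite -cardfs_gt0 card_fseq undup_id ?take_uniq ?fset_uniq// size_takel.
Qed.

(** * Compactness of the ball and the count of large coordinates *)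

Section ball_topology.
Context (R : realType) (G : groupType) (p : R) (p_ge1 : 1 <= p).
Local Notation X := (lp_ball G p).

Definition coord (x : X) (g : G) : R := set_val x g.

Let p_gt0 : 0 < p. Proof. exact: lt_le_trans p_ge1. Qed.

(** Finite partial sums are continuous for the product topology, which the infinite sum need not be;
    this form shows that the ball is closed. *)
Lemma lp_ball_setP (x : {ptws G -> R}) :
  lp_ball_set p x <-> forall D : {fset G}, \sum_(g <- D) `|x g| `^ p <= 1.
Proof.
split=> [xB D|xB].
  rewrite -lee_fin; apply: le_trans xB; apply: esum_ge.
  exists [set` D]; first by split=> //; exact: finite_fset.
  by rewrite fsbig_finite//= set_fsetK sumEFin.
apply: ge_ereal_sup => _ [D [finD _] <-].
by rewrite fsbig_finite//= sumEFin lee_fin.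
Qed.

Lemma coord_sum_le1 (x : X) (D : {fset G}) :
  \sum_(g <- D) `|coord x g| `^ p <= 1.
Proof. by have /set_mem/lp_ball_setP := valP x; apply. Qed.

Lemma norm_coord_le1 (x : X) (g : G) : `|coord x g| <= 1.
Proof.
have := coord_sum_le1 x [fset g]%fset; rewrite big_seq_fset1 => xg.
rewrite leNgt; apply/negP => g1; move: xg; apply/negP; rewrite -ltNge.
by apply: (lt_le_trans g1); apply: le1r_powR => //; exact: ltW.
Qed.

Lemma coord_continuous (g : G) : continuous (coord ^~ g).
Proof.
move=> x; apply: (@cvg_comp _ _ _ (set_val : X -> _) (fun y => y g) _
  (nbhs (set_val x))); last exact: ptws_coord_continuous.
exact: initial_continuous.
Qed.

(** The ball is a closed subset of the cube [[-1, 1]^G], compact by Tychonoff. *)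
Lemma lp_ball_compact : compact [set: X].
Proof.
apply: compact_set_type.
apply: (@subclosed_compact {ptws G -> R} _
  [set x | forall g, `[(-1 : R), 1]%classic (x g)]).
- rewrite (_ : lp_ball_set p = \bigcap_(D : {fset G})
      [set x | \sum_(g <- D) `|x g| `^ p <= 1]); last first.
    apply/seteqP; split=> [x /lp_ball_setP xB D _|x xB]; first exact: xB.
    by apply/lp_ball_setP => D; exact: xB.
  apply: closed_bigI => D _.
  apply: (@preimage_closed {ptws G -> R} _
    (fun x => \sum_(g <- D) `|x g| `^ p) [set t | t <= 1]).
    move=> x _; apply: sum_continuous => g {}x.
    apply: (@cvg_comp _ _ _ (fun x : {ptws G -> R} => x g)
      (fun t => `|t| `^ p) _ (nbhs (x g))).
      exact: ptws_coord_continuous.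
    exact: norm_powR_continuous.
  exact: closed_le.
- apply: (@tychonoff G (fun=> R) (fun=> `[(-1 : R), 1]%classic)) => g.
  exact: segment_compact.
- move=> x xB g; have := norm_coord_le1 (exist _ x (mem_set xB)) g.
  by rewrite ler_norml /= in_itv.
Qed.

(** Chebyshev's inequality: each such coordinate contributes at least [delta ^ p] to a sum bounded
    by [1]. *)
Lemma card_large_coords (x : X) (delta : R) (N : nat) (D : {fset G}) :
  0 < delta -> (delta `^ p)^-1 <= N%:R ->
  (forall g, g \in D -> delta <= `|coord x g|) -> (#|` D|%fset <= N)%N.
Proof.
move=> delta_gt0 deltaN Dx; rewrite -(ler_nat R); apply: le_trans deltaN.
have dp_gt0 : 0 < delta `^ p by exact: powR_gt0.
rewrite -div1r ler_pdivlMr//; apply: le_trans (coord_sum_le1 x D).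
rewrite card_fset_sum1 natr_sum mulr_suml big_seq [leRHS]big_seq.
apply: ler_sum => g gD; rewrite mul1r.
by apply: ge0_ler_powR; rewrite ?nnegrE ?(ltW delta_gt0) ?(ltW p_gt0)// Dx.
Qed.

End ball_topology.

(** * Soft thresholding as a map into a skeleton *)

Section soft_threshold.
Context (R : realType) (G : groupType) (p : R) (p_ge1 : 1 <= p).
Context (delta : R) (delta_gt0 : 0 < delta) (D : {fset G}).
Local Notation X := (lp_ball G p).
Local Notation DB := (D `*` [fset true; false])%fset.

(** The soft threshold of coordinate [g] is [excess x (g, true) - excess x (g, false)]; two
    nonnegative parts are kept because barycentric coordinates cannot be negative. *)
Definition excess (x : X) (v : G * bool) : R :=
  Num.max 0 ((if v.2 then coord x v.1 else - coord x v.1) - delta).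

Lemma excess_ge0 x v : 0 <= excess x v.
Proof. by rewrite le_max lexx. Qed.

Lemma excess_le1 x v : excess x v <= 1.
Proof.
rewrite /excess; have := norm_coord_le1 p_ge1 x v.1; rewrite ler_norml.
move=> /andP[? ?]; rewrite ge_max ler01 /=.
by have := delta_gt0; case: v.2; lra.
Qed.

Lemma excess_gt0 x v :
  0 < excess x v -> delta < if v.2 then coord x v.1 else - coord x v.1.
Proof. by rewrite lt_max ltxx subr_gt0. Qed.

Lemma excess_continuous v : continuous (excess ^~ v).
Proof.
have cc : continuous (fun x : X => coord x v.1) by exact: coord_continuous.
move=> x; apply: (@continuous_max R X (fun=> 0)
  (fun x => (if v.2 then coord x v.1 else - coord x v.1) - delta)).
  exact: cst_continuous.
apply: (@continuousB _ R^o); last exact: cst_continuous.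
by case: v.2; [exact: cc|apply: (@continuousN _ R^o); exact: cc].
Qed.

(** Equal excesses mean equal soft thresholds, and each coordinate is within [delta] of its own. *)
Lemma excess_inj x y g :
  (forall b, excess x (g, b) = excess y (g, b)) ->
  `|coord x g - coord y g| <= delta *+ 2.
Proof.
move=> xy; have := xy true; have := xy false; rewrite /excess /= mulr2n.
have := delta_gt0; case: (ltP 0 (coord x g - _)) => ?;
  case: (ltP 0 (coord y g - _)) => ?; case: (ltP 0 (- coord x g - _)) => ?;
  case: (ltP 0 (- coord y g - _)) => ? *;
  by rewrite ler_norml; apply/andP; split; lra.
Qed.

Lemma excess_true_false x g :
  0 < excess x (g, true) -> ~ 0 < excess x (g, false).
Proof.
by have := delta_gt0; move=> + /excess_gt0 /= + /excess_gt0 /=; lra.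
Qed.

Definition excess_support (x : X) : {fset G * bool} :=
  [fset v in DB | 0 < excess x v]%fset.

Lemma in_excess_support x v :
  (v \in excess_support x) = (v \in DB) && (0 < excess x v).
Proof. by rewrite !inE. Qed.

Context (N : nat) (delta_N : (delta `^ p)^-1 <= N%:R).

(** At most one sign survives for each [g], so [fst] is injective on the support and its image
    consists of large coordinates. *)
Lemma card_excess_support x : (#|` excess_support x|%fset <= N)%N.
Proof.
rewrite -(@card_in_imfset imfset_key _ _ fst (mem (excess_support x))).
  apply: (card_large_coords p_ge1 (x := x) delta_gt0 delta_N) => g.
  move=> /imfsetP[v /=]; rewrite in_excess_support => /andP[_ /excess_gt0 vx ->].
  apply: ltW; apply: lt_le_trans vx _.
  by case: v.2; rewrite ?ler_norm// -normrN ler_norm.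
move=> [g b] [g' b']; rewrite !in_excess_support => /andP[_ xb] /andP[_ xb'] /= gg'.
move: xb xb'; rewrite -gg'; case: b; case: b' => //.
  by move=> /excess_true_false.
by move=> + /excess_true_false.
Qed.

(* The vertices (g, true) and (g, false) carry the positive and the negative part
   of the thresholded coordinate g, and None carries the remaining mass. *)
Definition bary (x : X) : {ptws option (G * bool) -> R} := fun o =>
  match o with
  | Some v => if v \in DB then excess x v / N.+1%:R else 0
  | None => 1 - \sum_(v <- DB) excess x v / N.+1%:R
  end.

Definition bary_support (x : X) : {fset option (G * bool)} :=
  (None |` (Some @` excess_support x))%fset.

Lemma excess_sum x (f : R -> R) : f 0 = 0 ->
  \sum_(v <- DB) f (excess x v) = \sum_(v <- excess_support x) f (excess x v).
Proof.
move=> f0; symmetry; apply: big_fset_incl.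
  by apply/fsubsetP => v; rewrite in_excess_support => /andP[].
move=> v vDB; rewrite in_excess_support vDB /= -leNgt => v0.
by rewrite (_ : excess x v = 0)//; apply/eqP; rewrite eq_le v0 excess_ge0.
Qed.

Lemma bary_face x : face (bary_support x) (bary x).
Proof.
(* The excesses sum to at most [N], being at most [N] positive terms bounded by [1]. Dividing by
   [N.+1] leaves nonnegative mass for [None], and is legitimate even when [N] is [0]. *)
have M_gt0 : 0 < N.+1%:R :> R by rewrite ltr0n.
have sumE := @excess_sum x (fun t => t / N.+1%:R) (mul0r _).
split.
- case=> [v|] /=.
    by case: ifP => // _; rewrite divr_ge0 ?excess_ge0.
  rewrite subr_ge0 sumE -mulr_suml ler_pdivrMr// mul1r.
  apply: (@le_trans _ _ (\sum_(v <- excess_support x) 1)).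
    by apply: ler_sum => v _; exact: excess_le1.
  have := card_excess_support x.
  rewrite -(ler_nat R) card_fset_sum1 natr_sum => /le_trans; apply.
  by rewrite ler_nat.
- case=> [v|] /=; last by rewrite !inE.
  rewrite in_fset1U /= mem_imfset /=; last by move=> ? ? [].
  rewrite in_excess_support; case: ifP => //= vDB; rewrite -leNgt => v0.
  rewrite (_ : excess x v = 0) ?mul0r//.
  by apply/eqP; rewrite eq_le v0 excess_ge0.
- rewrite big_fsetU1 /=; last by apply/negP => /imfsetP[].
  rewrite big_imfset /=; last by move=> ? ? _ _ [].
  rewrite sumE; apply/eqP; rewrite eq_sym -subr_eq; apply/eqP; congr (1 - _).
  rewrite big_seq [RHS]big_seq; apply: eq_bigr => v.
  by rewrite in_excess_support => /andP[-> _].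
Qed.

Lemma bary_continuous o : continuous (bary ^~ o).
Proof.
have ce v : continuous (fun x => excess x v / N.+1%:R).
  move=> x; apply: (@continuousM R X); last exact: cst_continuous.
  exact: excess_continuous.
case: o => [v|]; rewrite /bary.
  by case: (v \in DB); [exact: ce|exact: cst_continuous].
move=> x; apply: (@continuousB _ R^o); first exact: cst_continuous.
exact: sum_continuous.
Qed.

(** The coordinates of [bary] at [Some v] determine the excesses on [DB], which gives the bound on
    fibres. All supports lie in one finite vertex set, which gives weak continuity. *)
Lemma threshold_map :
  exists2 f : X -> polyhedron R (skeleton (option (G * bool)) N),
    continuous f &
    forall x y, f x = f y ->
      {in D, forall g, `|coord x g - coord y g| <= delta *+ 2}.
Proof.
have skel x : simplices (skeleton _ N) (bary_support x).
  split; first by apply/fset0Pn; exists None; rewrite !inE.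
  rewrite cardfsU1 card_imfset; last by move=> ? ? [].
  rewrite (leq_add (leq_b1 _))//; exact: card_excess_support.
have baryP x : polyhedron_set (skeleton _ N) (bary x).
  by exists (bary_support x) => //; exact: bary_face.
pose f x : polyhedron R (skeleton (option (G * bool)) N) :=
  exist (fun y => y \in polyhedron_set _) (bary x) (mem_set (baryP x)).
exists f.
  apply: (@continuous_polyhedron _ _ _ _ _ (None |` (Some @` DB))%fset).
    exact: bary_continuous.
  move=> x; exists (bary_support x); split=> //; last exact: bary_face.
  apply: fsetUS; apply/fsubsetP => _ /imfsetP[v /= + ->].
  by rewrite in_excess_support => /andP[vDB _]; exact: in_imfset.
move=> x y [fxy] g gD; apply: excess_inj => b.
have /= := congr1 (@^~ (Some (g, b))) fxy.
rewrite !inE /= gD; case: b => /=.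
all: by move/mulIf; apply; rewrite invr_eq0 pnatr_eq0.
Qed.

End soft_threshold.

(** * From closeness of coordinates to bounds on [Widim] *)

Section compatible_distance.
Context (R : realType) (G : groupType) (p : R) (p_ge1 : 1 <= p).
Local Notation X := (lp_ball G p).
Context (d : X -> X -> R) (d_dist : is_distance d)
  (d_compat : compatible_distance d).

(* Ultrafilter form of the Lebesgue number argument: were the claim false, some
   ultrafilter on [X * X] would have both its projections converging to the
   same point while [d > eps] along it. *)
Lemma dist_coord_modulus (eps : R) : 0 < eps ->
  exists (A : {fset G}) (eta : R), 0 < eta /\
    forall x y, {in A, forall g, `|coord x g - coord y g| <= eta} ->
      d x y <= eps.
Proof.
move=> eps_gt0; apply: contrapT => no_modulus.
pose B (i : {fset G} * R) : set (X * X) :=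
  [set xy | {in i.1, forall g, `|coord xy.1 g - coord xy.2 g| <= i.2} /\
            eps < d xy.1 xy.2].
pose F := filter_from [set i : {fset G} * R | 0 < i.2] B.
have PF : ProperFilter F.
  apply: filter_from_proper.
    apply: filter_from_filter; first by exists (fset0, 1) => /=.
    move=> [A e] [A' e'] /= e_gt0 e'_gt0.
    exists ((A `|` A')%fset, Num.min e e'); first by rewrite /= lt_min e_gt0.
    move=> xy [/= close far]; split; split=> // g /= gA.
      by have := close g; rewrite inE gA le_min => /(_ isT)/andP[].
    by have := close g; rewrite inE gA orbT le_min => /(_ isT)/andP[].
  move=> [A e] /= e_gt0; apply: contrapT => nB; apply: no_modulus.
  exists A, e; split=> // x y close; rewrite leNgt; apply/negP => far.
  by apply: nB; exists (x, y).
have [U [UU FU]] := ultraFilterLemma PF.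
have fst_onto : range (@fst X X) = setT.
  by apply/seteqP; split=> // x _; exists (x, x).
have UfU := ultra_image UU fst_onto.
have := @lp_ball_compact R G p p_ge1; rewrite compact_ultra.
move=> /(_ _ UfU)[|l [_ fstUl]].
  by exists setT; [exact: filterT|exact: fst_onto].
have U1 : fst xy @[xy --> U] --> l.
  move=> W /fstUl[C UC CW]; apply: (@filterS _ U _ C) UC => xy Cxy.
  by rewrite /= -CW; exists xy.
(* The sets [B] force each coordinate difference to [0] along [U], so the second projection inherits
   the limit coordinatewise. *)
have U2 : snd xy @[xy --> U] --> l.
  apply: set_type_cvg; apply: ptws_cvg => g.
  have Ug : coord xy.1 g @[xy --> U] --> coord l g.
    apply: (@cvg_comp _ _ _ (@fst X X) (fun x : X => coord x g) U (nbhs l)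
      (nbhs (coord l g))); first exact: U1.
    exact: coord_continuous.
  have Ud : coord xy.1 g - coord xy.2 g @[xy --> U] --> 0.
    apply/cvgr0Pnorm_le => e e_gt0; apply: FU.
    exists ([fset g]%fset, e) => // xy [/= close _]; apply: close.
    by rewrite inE.
  have := cvgB Ug Ud; rewrite subr0.
  have -> : (fun xy : X * X => coord xy.1 g) -
      (fun xy => coord xy.1 g - coord xy.2 g) = (fun xy => coord xy.2 g).
    by apply/funext => xy; rewrite /= opprB addrC subrK.
  exact.
have near_l : nbhs l [set y | d l y < eps / 2].
  by apply/d_compat; exists (eps / 2); rewrite ?divr_gt0.
have far : U [set xy | eps < d xy.1 xy.2].
  by apply: FU; exists (fset0, 1) => [|xy []//]; exact: ltr01.
have near12 : U [set xy | d l xy.1 < eps / 2 /\ d l xy.2 < eps / 2].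
  by apply: filterI; [exact: (U1 _ near_l)|exact: (U2 _ near_l)].
have [xy [[/= d1 d2] d12]] := filter_ex (filterI near12 far).
have [_ d_sym d_tri] := d_dist.
have := d_tri xy.1 l xy.2; rewrite (d_sym xy.1 l) /=.
by move: d1 d2 d12 => /=; lra.
Qed.

Lemma le_dist_on (Om Om' : {fset G}) x y :
  (Om `<=` Om')%fset -> dist_on d Om x y <= dist_on d Om' x y.
Proof.
move=> /fsubsetP sOm; rewrite /dist_on big_seq; apply: bigmax_le.
  exact: bigmax_ge_id.
by move=> g /sOm gOm'; exact: (le_bigmax_seq 0 g xpredT).
Qed.

Lemma Widim_dist_on_bounded (eps : R) :
  infinite_set [set: G] -> 0 < eps ->
  exists N : nat, forall Om : {fset G}, (Widim (dist_on d Om) eps <= N%:R%:E)%E.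
Proof.
move=> G_infinite eps_gt0.
have [A [eta [eta_gt0 close_d]]] := dist_coord_modulus eps_gt0.
have delta_gt0 : 0 < eta / 2 by rewrite divr_gt0.
(* Since [eta] comes from [d] and [eps], [N] is fixed before [Om] is introduced. *)
pose N := (Num.bound ((eta / 2) `^ p)^-1).
have delta_N : ((eta / 2) `^ p)^-1 <= N%:R.
  by apply/ltW/archi_boundP; rewrite invr_ge0 powR_ge0.
exists N => Om.
(* Coordinate [a] of [lp_ball_act x g] is coordinate [g * a] of [x], so control on [D] gives control
   on [A] for every translate by [Om]. *)
pose D := [fset (g * a)%g | g in Om, a in A]%fset.
have [f cf fD] := threshold_map p_ge1 delta_gt0 D delta_N.
apply: ereal_inf_lbound; exists N => //.
exists (option (G * bool)), (skeleton _ N), f; split.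
  apply: skeleton_dim => fin; apply: G_infinite.
  rewrite -(preimage_setT (fun g : G => Some (g, true))).
  by apply: finite_preimage fin => g g' _ _ [].
split=> // z; apply: ge_ereal_sup => _ [x fx [y fy <-]].
rewrite lee_fin /dist_on big_seq; apply: bigmax_le; first exact: ltW.
move=> g gOm; apply: close_d => a aA.
have := fD x y (etrans fx (esym fy)) (g * a)%g; rewrite (_ : eta / 2 *+ 2 = eta); last by lra.
by apply; exact: in_imfset2.
Qed.
(** [Om0] realizes the largest value of [Widim] over nonempty finite sets; a larger set can neither
    exceed it nor fall below it. *)
Lemma Widim_stable (eps : R) (N : nat) :
  (forall Om : {fset G}, (Widim (dist_on d Om) eps <= N%:R%:E)%E) ->
  exists Om0 : {fset G}, Om0 != fset0 /\
    forall Om : {fset G}, (Om0 `<=` Om)%fset ->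
      Widim (dist_on d Om) eps = Widim (dist_on d Om0) eps.
Proof.
move=> W_le_N.
have W_nat Om : exists n : nat, Widim (dist_on d Om) eps = n%:R%:E.
  have [n An _] := nat_min_le (W_le_N Om).
  by have [m _ ?] := nat_min_attained R (ex_intro _ n An); exists m.
pose P n := `[< exists Om : {fset G},
  Om != fset0 /\ Widim (dist_on d Om) eps = n%:R%:E >].
have exP : exists n, P n.
  have [n Wn] := W_nat [fset 1%g]%fset; exists n; apply/asboolP.
  by exists [fset 1%g]%fset; split=> //; apply/fset0Pn; exists 1%g; rewrite inE.
have P_le n : P n -> (n <= N)%N.
  by move=> /asboolP[Om [_ Wn]]; have := W_le_N Om; rewrite Wn lee_fin ler_nat.
case: (ex_maxnP exP P_le) => n /asboolP[Om0 [Om0_neq0 Wn]] n_max.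
exists Om0; split=> // Om sOm; apply/eqP; rewrite eq_le; apply/andP; split.
  have [m Wm] := W_nat Om; rewrite Wm Wn lee_fin ler_nat; apply: n_max.
  apply/asboolP; exists Om; split=> //.
  by apply: contraNneq Om0_neq0 => Om_eq0; rewrite -fsubset0 -Om_eq0.
by apply: le_Widim => x y; exact: le_dist_on.
Qed.

End compatible_distance.

(** * Boundaries for the word metric *)

Section word_metric.
Context (R : realType) (G : groupType) (S : {fset G}).

Lemma word_dist_le1P (g h : G) :
  (word_dist R S g h <= 1%:E)%E <->
  [\/ h = g, (g^-1 * h)%g \in S | (h^-1 * g)%g \in S].
Proof.
split=> [/nat_min_le[n [w [wS wgh] wn]]|].
  rewrite (ler_nat R n 1) -wn; case: w wS wgh wn => [|s [|? ?]] //= wS.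
    rewrite big_nil => /esym gh _ _; apply: Or31.
    by rewrite -[h](mulVKg g) gh mulg1.
  rewrite big_seq1 => sE _ _; have [] := wS s (mem_head _ _).
    by rewrite sE; exact: Or32.
  by rewrite sE invgM invgK; exact: Or33.
have le1 (w : seq G) : is_word S (g^-1 * h)%g w -> (size w <= 1)%N ->
    (word_dist R S g h <= 1%:E)%E.
  move=> wgh w1; apply: (@le_trans _ _ (size w)%:R%:E).
    by apply: ereal_inf_lbound; exists (size w) => //; exists w.
  by rewrite lee_fin (ler_nat R _ 1).
case=> [hg|sS|sS].
- by apply: (le1 [::]) => //; split=> //; rewrite big_nil hg mulVg.
- apply: (le1 [:: (g^-1 * h)%g]) => //; split; last by rewrite big_seq1.
  by move=> s; rewrite inE => /eqP ->; left.
- apply: (le1 [:: (g^-1 * h)%g]) => //; split; last by rewrite big_seq1.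
  by move=> s; rewrite inE => /eqP ->; right; rewrite invgM invgK.
Qed.

(** Finiteness ensures that [fset_set] returns the boundary itself. Every boundary point is a point
    of [Om] times an element of [T], the unit ball around [1]. *)
Lemma boundary1_finite (Om : {fset G}) : finite_set (boundary S (1 : R) Om).
Proof.
pose T := (1%g |` (S `|` [fset s^-1 | s in S]))%g%fset.
apply: (@sub_finite_set _ _ [set` [fset (h * t)%g | h in Om, t in T]%fset]);
  last exact: finite_fset.
move=> g [[h [/word_dist_le1P gh hOm]] _] /=; apply/imfset2P.
exists h => //; exists (h^-1 * g)%g; last by rewrite mulVKg.
rewrite /T !inE; case: gh => [->|gh|->]; first by rewrite mulVg eqxx.
  apply/orP; right; apply/orP; right; apply/imfsetP; exists (g^-1 * h)%g => //.
  by rewrite invgM invgK.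
by rewrite orbT.
Qed.

(** With empty boundary, [Om] would be stable under right multiplication by generators and their
    inverses, hence would be all of [G], which is infinite. *)
Lemma boundary1_neq0 (Om : {fset G}) :
  infinite_set [set: G] -> generates S -> Om != fset0 ->
  boundary S (1 : R) Om !=set0.
Proof.
move=> G_infinite S_gen /fset0Pn[g0 g0Om]; apply: contrapT => no_boundary.
have Om_closed g h : g \in Om ->
    [\/ h = g, (g^-1 * h)%g \in S | (h^-1 * g)%g \in S] -> h \in Om.
  move=> gOm gh; apply: contrapT => hOm; apply: no_boundary; exists g; split.
    by exists g; split=> //; apply/word_dist_le1P; exact: Or31.
  by exists h; split=> //; exact/word_dist_le1P.
have Om_words (w : seq G) g : {in w, forall s, s \in S \/ (s^-1)%g \in S} ->
    g \in Om -> (g * \prod_(s <- w) s)%g \in Om.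
  elim: w g => [|s w IHw] g wS gOm; first by rewrite big_nil mulg1.
  rewrite big_cons mulgA; apply: IHw.
    by move=> t tw; apply: wS; rewrite inE tw orbT.
  apply: Om_closed gOm _; have [] := wS s (mem_head _ _) => sS.
    by apply: Or32; rewrite mulKg.
  by apply: Or33; rewrite invgM mulgVK.
apply: G_infinite; apply: sub_finite_set (finite_fset Om) => g _ /=.
have [w [wS wE]] := S_gen (g0^-1 * g)%g.
by have := Om_words w g0 wS g0Om; rewrite wE mulVKg.
Qed.

Lemma boundary_ratio_ge (Om : {fset G}) :
  infinite_set [set: G] -> generates S -> Om != fset0 ->
  (#|` Om|%fset%:R)^-1 <=
  #|` fset_set (boundary S (1 : R) Om)|%fset%:R / #|` Om|%fset%:R :> R.
Proof.
move=> G_infinite S_gen Om_neq0.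
rewrite -[leLHS]mul1r ler_wpM2r ?invr_ge0// (ler_nat R 1) cardfs_gt0.
have [g bg] := boundary1_neq0 G_infinite S_gen Om_neq0.
by apply/fset0Pn; exists g; rewrite in_fset_set ?inE//; exact: boundary1_finite.
Qed.

End word_metric.

Theorem corollary1p5 (R : realType) (G : groupType)
    (G_countable : countable [set: G]) (G_infinite : infinite_set [set: G])
    (p : R) (p_ge1 : 1 <= p)
    (d : lp_ball G p -> lp_ball G p -> R)
    (d_dist : is_distance d) (d_compat : compatible_distance d) :
  (forall eps : R, 0 < eps ->
     (exists C : R, 0 < C /\
        forall Om : {fset G}, Om != fset0 ->
          (Widim (dist_on d Om) eps <= C%:E)%E) /\
     (exists Om0 : {fset G}, Om0 != fset0 /\
        forall Om : {fset G}, (Om0 `<=` Om)%fset ->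
          Widim (dist_on d Om) eps = Widim (dist_on d Om0) eps)) /\
  (forall (S : {fset G}) (Om : nat -> {fset G}),
     generates S -> amenable_sequence R S Om ->
     mean_dim_exists d Om /\ mean_dim d Om = 0%E).
Proof.
split=> [eps eps_gt0|S Om S_gen [Om_neq0 Om_amen]].
  have [N W_le_N] :=
    Widim_dist_on_bounded p_ge1 d_dist d_compat G_infinite eps_gt0.
  split; last exact: Widim_stable W_le_N.
  exists N.+1%:R; split; first by rewrite ltr0n.
  by move=> Om _; apply: (le_trans (W_le_N Om)); rewrite lee_fin ler_nat.
have ratio_cvg0 eps : 0 < eps -> widim_ratio d Om eps i @[i --> \oo] --> 0%E.
  move=> eps_gt0.
  have [N W_le_N] :=
    Widim_dist_on_bounded p_ge1 d_dist d_compat G_infinite eps_gt0.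
  pose b i : R := #|` fset_set (boundary S (1 : R) (Om i))|%fset%:R
    / #|` Om i|%fset%:R.
  (* The ratio is at most [N / |Om i|], and [boundary_ratio_ge] replaces the inverse cardinality by
     [b i], which amenability at radius [1] sends to [0]. *)
  apply: (@squeeze_cvge _ _ _ _ (fun=> 0%E) _ (fun i => (N%:R * b i)%:E)).
  - apply: nearW => i; apply/andP; split.
      rewrite mule_ge0 ?lee_fin ?invr_ge0//.
      by apply: le_ereal_inf_tmp => _ [n _ <-]; rewrite lee_fin.
    rewrite EFinM; apply: lee_pmul.
    + by apply: le_ereal_inf_tmp => _ [n _ <-]; rewrite lee_fin.
    + by rewrite lee_fin invr_ge0.
    + exact: W_le_N.
    + by rewrite lee_fin; exact: boundary_ratio_ge.
  - exact: cvg_cst.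
  - apply/fine_cvgP; split; first exact: nearW.
    rewrite -(mulr0 N%:R); apply: cvgM; first exact: cvg_cst.
    exact: Om_amen.
have density0 eps : 0 < eps -> widim_density d Om eps = 0%E.
  by move=> /ratio_cvg0 cvg0; exact: (cvg_lim (@ereal_hausdorff R) cvg0).
(* The density vanishes for every positive [eps], so the right-hand limit is that of a constant. *)
have density_cvg : widim_density d Om eps @[eps --> 0^'+] --> 0%E.
  apply: cvg_near_cst; near=> eps; apply: density0.
  by near: eps; exact: nbhs_right_gt.
split; last exact: (cvg_lim (@ereal_hausdorff R) density_cvg).
split; last by apply/cvg_ex; exists 0%E.
by move=> eps /ratio_cvg0 cvg0; apply/cvg_ex; exists 0%E.
Unshelve. all: by end_near. Qed.
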